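(* Let $(\mathcal{G},\omega)$ be a Cartan geometry of type $(G,H)$ over a connected manifold $M$, let $o\in\mathcal{G}$, and let $J\leq G$ be a subgroup containing $\mathrm{Hol}_o(\mathcal{G},\omega)$. Let $\varphi\in\mathrm{Aut}(\mathcal{G},\omega)$. If $\varphi(o)\in o\bullet N_G(J)$, where $N_G(J)$ is the normalizer of $J$ in $G$, then $\varphi(J\bullet u)=J\bullet\varphi(u)$ for all $u\in\mathcal{G}$, where curved right cosets are taken with respect to the basepoint $o$.
   Context: A model geometry $(G,H)$ is a Lie group $G$ with a closed subgroup $H$ such that $G/H$ is connected. A Cartan geometry $(\mathcal{G},\omega)$ of type $(G,H)$ over $M$ is a (right) principal $H$-bundle $q_H:\mathcal{G}\to M$ with a $\mathfrak{g}$-valued 1-form $\omega$ such that each $\omega_u:T_u\mathcal{G}\to\mathfrak{g}$ is a linear isomorphism, $R_h^*\omega=\mathrm{Ad}_{h^{-1}}\omega$ for $h\in H$, and for $Y\in\mathfrak{h}$ the flow of $\omega^{-1}(Y)$ is $u\mapsto u\exp(tY)$. $\mathrm{Aut}(\mathcal{G},\omega)$ is the group of bijective $H$-equivariant maps $\varphi:\mathcal{G}\to\mathcal{G}$ with $\varphi^*\omega=\omega$. Paths are piecewise smooth. The development of a path $\gamma:[0,1]\to\mathcal{G}$ is the unique path $\gamma_G$ in $G$ with $\gamma_G(0)=e$ and $\gamma^*\omega=\gamma_G^*\omega_G$, $\omega_G$ the Maurer–Cartan form. An element $g\in G$ is a development of $u'\in\mathcal{G}$ from $u\in\mathcal{G}$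 if there are a path $\gamma:[0,1]\to\mathcal{G}$ and $h\in H$ with $\gamma(0)=u$, $\gamma(1)h=u'$, $\gamma_G(1)h=g$. The holonomy group is $\mathrm{Hol}_u(\mathcal{G},\omega)=\{\gamma_G(1)h: h\in H,\ \gamma(0)=u=\gamma(1)h\}$. For a subgroup $J\leq G$ containing $\mathrm{Hol}_u(\mathcal{G},\omega)$, the curved (left) coset is $u\bullet J=\{\gamma(1)h: h\in H,\ \gamma(0)=u,\ \gamma_G(1)h\in J\}$, the set of points with a development from $u$ in $J$. For a fixed basepoint $o$ with $\mathrm{Hol}_o(\mathcal{G},\omega)\leq J$, the curved (right) coset through $u$ is $J\bullet u:=u\bullet(g^{-1}Jg)$, where $g$ is any development of $u$ from $o$ (independent of the choice of $g$). *)

(* Defs.v *)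
From HB Require Import structures.
From mathcomp Require Import all_boot all_order all_algebra.
From mathcomp Require Import generic_quotient.
From mathcomp Require Import all_classical all_reals all_analysis.
Set Implicit Arguments.
Unset Strict Implicit.
Unset Printing Implicit Defensive.
Import Order.TTheory GRing.Theory Num.Theory.
Import numFieldNormedType.Exports.
Local Open Scope classical_set_scope.
Local Open Scope ring_scope.

Section smooth_normed.
Context {R : realType} {V W : normedModType R}.

(* For finite-dimensional V (the only case used below), the differential of f
   is C^k as soon as x |-> 'd f x v is C^k for every fixed vector v. *)
Fixpoint Ck (k : nat) (U : set V) (f : V -> W) : Prop :=
  match k with
  | 0%N => forall x, U x -> {for x, continuous f}
  | k'.+1 => (forall x, U x -> differentiable f x) /\
             (forall v, Ck k' U (fun x => 'd f x v))
  end.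

Definition smooth_on (U : set V) (f : V -> W) : Prop := forall k, Ck k U f.

Definition smooth_near (f : V -> W) (x : V) : Prop :=
  exists U : set V, [/\ open U, U x & smooth_on U f].

End smooth_normed.

(* chart_map and chart_inv are total functions, but they are only meaningful on
   chart_dom and on its image. *)
Record chart (R : realType) (n : nat) (T : topologicalType) := Chart {
  chart_dom : set T;
  chart_map : T -> 'rV[R]_n;
  chart_inv : 'rV[R]_n -> T;
  chart_dom_open : open chart_dom;
  chart_img_open : open (chart_map @` chart_dom);
  chart_mapK : {in chart_dom, cancel chart_map chart_inv};
  chart_map_continuous : forall p, chart_dom p -> {for p, continuous chart_map};
  chart_inv_continuous : forall x, (chart_map @` chart_dom) x ->
    {for x, continuous chart_inv}
}.

(* The smooth structure is given by an atlas indexed by the points of the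
   manifold, chart_at p being a chart around p. *)
HB.mixin Record Topological_isManifold (R : realType) (n : nat) T
    of Topological T := {
  chart_at : T -> chart R n T;
  chart_at_dom : forall p, chart_dom (chart_at p) p;
  chart_at_compat : forall p q,
    smooth_on
      (chart_map (chart_at p) @`
         (chart_dom (chart_at p) `&` chart_dom (chart_at q)))
      (chart_map (chart_at q) \o chart_inv (chart_at p));
  manifold_hausdorff : hausdorff_space T;
  manifold_second_countable : @second_countable T
}.

#[short(type="manifoldType")]
HB.structure Definition Manifold (R : realType) (n : nat) :=
  {T of Topological T & Topological_isManifold R n T}.

Section smooth_maps.
Context {R : realType}.

Definition coord {n} {M : manifoldType R n} (p : M) : M -> 'rV[R]_n :=
  chart_map (chart_at p).
Definition param {n} {M : manifoldType R n} (p : M) : 'rV[R]_n -> M :=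
  chart_inv (chart_at p).

Definition vsmooth_at {V : normedModType R} {n} {N : manifoldType R n}
    (f : V -> N) (x : V) : Prop :=
  {for x, continuous f} /\ smooth_near (coord (f x) \o f) x.

Definition smooth_at {m n} {M : manifoldType R m} {N : manifoldType R n}
    (f : M -> N) (p : M) : Prop :=
  vsmooth_at (f \o param p) (coord p p).

(* Smoothness of a map on the product manifold M * N, read in product charts. *)
Definition smooth2_at {m n k} {M : manifoldType R m} {N : manifoldType R n}
    {P : manifoldType R k} (f : M -> N -> P) (p : M) (q : N) : Prop :=
  vsmooth_at
    (fun z : 'rV[R]_m * 'rV[R]_n => f (param p z.1) (param q z.2))
    (coord p p, coord q q).

(* Smoothness on the subset A * B of M * N, i.e. existence of local smooth
   extensions. When B is a closed subgroup of a Lie group N, this is smoothness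
   for its structure of embedded submanifold. *)
Definition smooth2_on {m n k} {M : manifoldType R m} {N : manifoldType R n}
    {P : manifoldType R k} (A : set M) (B : set N) (f : M -> N -> P) : Prop :=
  forall p q, A p -> B q ->
  exists (U : set M) (V : set N) (F : M -> N -> P),
    [/\ open_nbhs p U, open_nbhs q V,
        forall x y, U x -> V y -> smooth2_at F x y &
        forall x y, (U `&` A) x -> (V `&` B) y -> F x y = f x y].

(* The tangent space of M at p is 'rV[R]_n, a row vector standing for the
   tangent vector which has these coordinates in the chart chart_at p. *)
Definition tangent_map {m n} {M : manifoldType R m} {N : manifoldType R n}
    (f : M -> N) (p : M) : 'rV[R]_m -> 'rV[R]_n :=
  'd (coord (f p) \o f \o param p) (coord p p).

Definition velocity {n} {M : manifoldType R n} (c : R -> M) (t : R) :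
    'rV[R]_n :=
  derive1 (coord (c t) \o c) t.

(* A form on M with values in 'rV[R]_k is smooth when its coefficients in charts
   are; at a point param p x near p, the tangent vector with coordinates v in
   chart_at p has coordinates 'd (coord (param p x) \o param p) x v in the chart
   at that point. *)
Definition smooth_form {n k} {M : manifoldType R n}
    (w : M -> {linear 'rV[R]_n -> 'rV[R]_k}) : Prop :=
  forall (p : M) (v : 'rV[R]_n),
    smooth_near
      (fun x => w (param p x) ('d (coord (param p x) \o param p) x v))
      (coord p p).

(* c is smooth up to the endpoints of `[a, b]. *)
Definition smooth_on_segment {n} {M : manifoldType R n}
    (c : R -> M) (a b : R) : Prop :=
  exists d : R -> M, forall t, a <= t <= b ->
    c t = d t /\ vsmooth_at (d : R^o -> M) t.

(* Paths are functions on R of which only the values on `[0, 1] matter. *)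
Definition piecewise_smooth {n} {M : manifoldType R n} (c : R -> M) : Prop :=
  exists2 s : seq R, itv_partition 0 1 s &
    forall i, (i < size s)%N ->
      smooth_on_segment c (nth 0 (0 :: s) i) (nth 0 s i).

End smooth_maps.

HB.mixin Record Manifold_Group_isLieGroup (R : realType) (n : nat) G
    of Manifold R n G & Group G := {
  mulg_smooth : forall x y : G, smooth2_at (fun x y : G => (x * y)%g) x y;
  invg_smooth : forall x : G, smooth_at (fun x : G => (x^-1)%g) x
}.

#[short(type="lieGroupType")]
HB.structure Definition LieGroup (R : realType) (n : nat) :=
  {G of Manifold R n G & Group G & Manifold_Group_isLieGroup R n G}.

Definition subgroup {G : groupType} (J : set G) : Prop :=
  group_closed (mem J).

Definition conj_set {G : groupType} (J : set G) (g : G) : set G :=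
  [set (g^-1 * j * g)%g | j in J].

Definition normalizer {G : groupType} (J : set G) : set G :=
  [set g | conj_set J g = J].

Section cosets.
Context {G : groupType} (H : set G) (gH : subgroup H).

Let coset_rel' (x y : G) : bool := (x^-1 * y)%g \in H.

Local Lemma coset_rel_refl : reflexive coset_rel'.
Proof. by move=> x; rewrite /coset_rel' mulVg; case: gH. Qed.

Local Lemma coset_rel_sym : symmetric coset_rel'.
Proof.
have sub x y : coset_rel' x y -> coset_rel' y x.
  move=> xy; rewrite /coset_rel' -[(y^-1 * x)%g]invgK invgM invgK.
  exact: (group_closedV gH).
by move=> x y; apply/idP/idP; exact: sub.
Qed.

Local Lemma coset_rel_trans : transitive coset_rel'.
Proof.
move=> y x z xy yz; rewrite /coset_rel' -[z](mulVKg y) mulgA.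
exact: (group_closedM gH).
Qed.

Definition coset_rel := EquivRel _ coset_rel_refl coset_rel_sym coset_rel_trans.

End cosets.

Local Open Scope quotient_scope.

Record model_geometry (R : realType) (n : nat) (G : lieGroupType R n) := {
  stabilizer : set G;
  stabilizer_subgroup : subgroup stabilizer;
  stabilizer_closed : closed stabilizer;
  homogeneous_space_connected :
    connected [set: quotient_topology {eq_quot (coset_rel stabilizer_subgroup)}]
}.

Section lie_theory.
Context {R : realType} {n : nat} {G : lieGroupType R n}.

(* The Lie algebra of G is its tangent space at 1, the point g^-1 * g. *)
Definition maurer_cartan (g : G) : 'rV[R]_n -> 'rV[R]_n :=
  tangent_map (fun x : G => (g^-1 * x)%g) g.

Definition Ad (g : G) : 'rV[R]_n -> 'rV[R]_n :=
  tangent_map (fun x : G => (g * x * g^-1)%g) 1%g.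

(* e is the one-parameter group t |-> exp (t Y). *)
Definition is_exp (Y : 'rV[R]_n) (e : R -> G) : Prop :=
  [/\ forall t, vsmooth_at (e : R^o -> G) t,
      forall s t, e (s + t) = (e s * e t)%g &
      velocity e 0 = Y].

End lie_theory.

(* act u h stands for u h; its values for h outside H are irrelevant. *)
Record principal_bundle (R : realType) (n m k : nat) (G : lieGroupType R n)
    (H : set G) (M : manifoldType R m) (P : manifoldType R k)
    (q : P -> M) (act : P -> G -> P) : Prop := {
  act1 : forall u, act u 1%g = u;
  actM : forall u h h', H h -> H h' -> act u (h * h')%g = act (act u h) h';
  act_smooth : smooth2_on setT H act;
  bundle_proj_smooth : forall u, smooth_at q u;
  bundle_proj_act : forall u h, H h -> q (act u h) = q u;
  (* (q, tau) and psi are mutually inverse H-equivariant diffeomorphisms between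
     q @^-1` U and U * H. *)
  bundle_trivial : forall x : M, exists (U : set M) (tau : P -> G)
    (psi : M -> G -> P), open_nbhs x U /\
    [/\ forall u, U (q u) -> H (tau u) /\ smooth_at tau u,
        smooth2_on U H psi,
        forall u h, U (q u) -> H h -> tau (act u h) = (tau u * h)%g,
        forall u, U (q u) -> psi (q u) (tau u) = u &
        forall y h, U y -> H h -> q (psi y h) = y /\ tau (psi y h) = h]
}.

Record cartan_geometry (R : realType) (n m k : nat) (G : lieGroupType R n)
    (X : model_geometry G) (M : manifoldType R m) (P : manifoldType R k) := {
  proj : P -> M;
  act : P -> G -> P;
  cartan_bundle : principal_bundle (stabilizer X) proj act;
  cartan_form : P -> {linear 'rV[R]_k -> 'rV[R]_n};
  cartan_form_smooth : smooth_form cartan_form;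
  cartan_form_bij : forall u, bijective (cartan_form u);
  cartan_form_act : forall u h v, stabilizer X h ->
    cartan_form (act u h) (tangent_map (fun u' => act u' h) u v) =
    Ad h^-1%g (cartan_form u v);
  cartan_form_flow : forall (Y : 'rV[R]_n) (e : R -> G), is_exp Y e ->
    (forall t, stabilizer X (e t)) ->
    forall u t, cartan_form (act u (e t)) (velocity (fun s => act u (e s)) t) = Y
}.

Section curved_cosets.
Context {R : realType} {n m k : nat} {G : lieGroupType R n}.
Context {X : model_geometry G} {M : manifoldType R m} {P : manifoldType R k}.
Variable C : cartan_geometry X M P.

Definition automorphism (phi : P -> P) : Prop :=
  [/\ forall u, smooth_at phi u,
      bijective phi,
      forall u h, stabilizer X h -> phi (act C u h) = act C (phi u) h &
      forall u v,
        cartan_form C (phi u) (tangent_map phi u v) = cartan_form C u v].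

(* The pullbacks of the two forms are only required to agree outside a finite
   set, because paths are merely piecewise smooth. *)
Definition is_development (c : R -> P) (cG : R -> G) : Prop :=
  [/\ piecewise_smooth cG, cG 0 = 1%g &
      exists s : seq R, forall t, 0 < t < 1 -> t \notin s ->
        cartan_form C (c t) (velocity c t) =
        maurer_cartan (cG t) (velocity cG t)].

(* g is a development of u' from u. *)
Definition develops (u u' : P) (g : G) : Prop :=
  exists (c : R -> P) (cG : R -> G) (h : G),
    [/\ piecewise_smooth c, is_development c cG & stabilizer X h] /\
    [/\ c 0 = u, act C (c 1) h = u' & (cG 1%R * h)%g = g].

Definition holonomy (u : P) : set G := [set g | develops u u g].

Definition curved_lcoset (u : P) (J : set G) : set P :=
  [set u' | exists2 g, J g & develops u u' g].

(* The coset u . (g^-1 J g) does not depend on the development g of u from o when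
   holonomy o `<=` J, so that taking the union over all g amounts to picking one
   (developments of u from o exist if M is connected). *)
Definition curved_rcoset (o : P) (J : set G) (u : P) : set P :=
  [set u' | exists2 g, develops o u g & curved_lcoset u (conj_set J g) u'].

End curved_cosets.

(* Main.v *)
Require Import Defs.
From HB Require Import structures.
From mathcomp Require Import all_boot all_order all_algebra.
From mathcomp Require Import all_classical all_reals all_analysis.
From mathcomp Require Import ring lra.
Import Order.TTheory GRing.Theory Num.Theory.
Import numFieldNormedType.Exports.
Import Defs.
Local Open Scope classical_set_scope.
Local Open Scope ring_scope.

(** The relation that g is a development of v from u behaves like the arrows of a
    groupoid: developments compose (develops_trans), can be inverted
    (develops_sym), and are carried by an automorphism phi to developments
    between the image points (develops_automorphism), because phi preserves the
    Cartan form and hence the equation that defines the development of a curve.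

    Granting this, let g0 in N(J) be a development of phi o from o. If g is a
    development of u from o, then it is also one of phi u from phi o, so that
    g0 * g is a development of phi u from o. As g0 normalizes J, the subgroups
    g^-1 J g and (g0 g)^-1 J (g0 g) coincide; a point v with a development from
    u in the former is therefore sent to a point phi v with a development from
    phi u in the latter. This proves that phi maps the right coset of u into
    that of phi u (automorphism_rcoset_sub).

    The converse inclusion is the same statement for phi^-1: the element g0^-1
    of N(J) is a development of phi^-1 o from o. But an automorphism is only
    assumed to be a smooth bijection, so phi^-1 must first be shown to be smooth
    (automorphism_inverse). Since the Cartan form is bijective at every point
    and is preserved by phi, the differential of phi is injective everywhere,
    and the inverse function theorem (smooth_at_inverse) applies. Its proof is
    the classical one: local_inverse solves f x = y near a by the contraction
    x |-> x - B (f x - y), where B inverts the differential of f at a;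
    smooth_inverse then reads off from the formula
    'd g y = ('d f (g y))^-1 that the inverse g is as smooth as f.

    The statements on developments reduce to manipulations of curves. The
    Maurer-Cartan form of the velocity of c at t is the velocity at t of
    s |-> c(t)^-1 c(s) (maurer_cartan_velocity). In this form it is plain that
    the development equation is insensitive to left translations in G, while
    right translation of a curve of the bundle by h in H conjugates its
    development by h^-1 (development_on_act). Reversal and juxtaposition of
    curves then give inverses and products. *)

Set Implicit Arguments.
Unset Strict Implicit.
Unset Printing Implicit Defensive.

(** * Calculus of C^k maps *)

Section differential.
Context {R : realType} {V W : normedModType R}.
Implicit Types (f g : V -> W) (x : V).

Lemma diff_approx f x : differentiable f x -> forall e, 0 < e ->
  \forall y \near x, `|f y - f x - 'd f x (y - x)| <= e * `|y - x|.
Proof.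
move=> /diff_locallyP[_ /eqaddoP df] e e0.
apply/nbhs0P; apply: filterS (df _ e0) => h /=.
by rewrite !fctE /= (addrC x h) addrK opprD addrA.
Qed.

(** Converse of diff_approx. An error bound in this form only involves the values
    of f near x, and it identifies the differential, which is what both the
    locality of differentials and the differentiation of inverse maps use. *)
Lemma diff_of_approx f x (L : {linear V -> W}) : continuous L ->
  (forall e, 0 < e -> \forall y \near x,
     `|f y - f x - L (y - x)| <= e * `|y - x|) ->
  differentiable f x /\ 'd f x = L :> (V -> W).
Proof.
move=> cL fL.
have H : f \o shift x = cst (f x) + L +o_ 0 id.
  apply/eqaddoP => e e0; have /nbhs0P := fL _ e0; apply: filterS => h /=.
  by rewrite !fctE /= (addrC x h) addrK opprD addrA.
have dE := diff_unique cL H.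
by split=> //; apply/diff_locallyP; rewrite dE.
Qed.

Lemma near_eq_diff f g x : (\forall y \near x, f y = g y) ->
  differentiable f x ->
  differentiable g x /\ 'd g x = 'd f x :> (V -> W).
Proof.
move=> fg df; apply: diff_of_approx; first exact: diff_continuous.
move=> e e0; have fgx := nbhs_singleton fg.
near=> y.
have <- : f y = g y by near: y.
by rewrite -fgx; near: y; exact: diff_approx.
Unshelve. all: by end_near. Qed.

End differential.

Section Ck_locality.
Context {R : realType} {V W : normedModType R}.
Implicit Types (f g : V -> W) (A B : set V).

Lemma Ck_subset k A B f : A `<=` B -> Ck k B f -> Ck k A f.
Proof.
move=> AB; elim: k f => [|k IH] f /=; first by move=> H x /AB /H.
by move=> [H1 H2]; split=> [x /AB /H1//|v]; exact: IH.
Qed.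

(** Openness of A matters: differentials at a point of A see a neighbourhood. *)
Lemma Ck_ext k A f g : open A -> (forall x, A x -> f x = g x) ->
  Ck k A f -> Ck k A g.
Proof.
move=> oA; elim: k f g => [|k IH] f g fg /=.
  move=> cf x Ax.
  have fgx : {near x, f =1 g}.
    by apply: filterS (open_nbhs_nbhs (conj oA Ax)) => y; exact: fg.
  have := cf _ Ax; rewrite /prop_for /continuous_at -fg//.
  by apply: cvg_trans; apply: near_eq_cvg; apply: filterS fgx => y ->.
move=> [df Cf].
have H x : A x -> differentiable g x /\ 'd g x = 'd f x :> (V -> W).
  move=> Ax; apply: near_eq_diff; last exact: df.
  by apply: filterS (open_nbhs_nbhs (conj oA Ax)) => y; exact: fg.
split=> [x /H[]//|v]; apply: IH (Cf v) => x /H[_ ->//].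
Qed.

Lemma CkS k A f : Ck k.+1 A f -> Ck k A f.
Proof.
elim: k f => [|k IH] f [df Cf]; first by move=> x /df /differentiable_continuous.
by split=> // v; apply: IH; exact: Cf.
Qed.

Lemma Ck_cst k A (c : W) : Ck k A (fun _ : V => c).
Proof.
elim: k c => [|k IH] c /=; first by move=> x _; exact: cvg_cst.
split=> [x _|v]; first exact: differentiable_cst.
have -> : (fun x : V => 'd (fun=> c) x v) = (fun _ => 0) by
  apply/funext => x; rewrite (diff_cst c x).
exact: IH.
Qed.

Lemma CkD k A f g : open A -> Ck k A f -> Ck k A g -> Ck k A (fun x => f x + g x).
Proof.
move=> oA; elim: k f g => [|k IH] f g /=.
  by move=> cf cg x Ax; apply: cvgD; [exact: cf|exact: cg].
move=> [df Cf] [dg Cg]; split=> [x Ax|v].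
  exact: (differentiableD (df _ Ax) (dg _ Ax)).
apply: Ck_ext (IH _ _ (Cf v) (Cg v)) => // x Ax.
by rewrite (_ : (fun x => f x + g x) = f + g)// diffD//; auto.
Qed.

Lemma Ck_sum k A (I : Type) (r : seq I) (F : I -> V -> W) : open A ->
  (forall i, Ck k A (F i)) -> Ck k A (fun x => \sum_(i <- r) F i x).
Proof.
move=> oA CF; elim: r => [|i r IH].
  by under eq_fun do rewrite big_nil; exact: Ck_cst.
by under eq_fun do rewrite big_cons; exact: CkD.
Qed.

End Ck_locality.

Section Ck_products.
Context {R : realType} {V : normedModType R}.
Implicit Types A : set V.

Lemma Ck_linear_comp {W Z : normedModType R} k A (f : V -> W)
    (L : {linear W -> Z}) :
  open A -> continuous L -> Ck k A f -> Ck k A (fun x => L (f x)).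
Proof.
move=> oA cL; elim: k f => [|k IH] f /=.
  by move=> cf x Ax; apply: continuous_comp; [exact: cf|exact: cL].
move=> [df Cf]; split=> [x Ax|v].
  exact: (differentiable_comp (df _ Ax) (linear_differentiable _ cL)).
apply: Ck_ext (IH _ (Cf v)) => // x Ax.
have -> : 'd (fun x => L (f x)) x = 'd L (f x) \o 'd f x :> (V -> Z).
  exact: (diff_comp (df _ Ax) (linear_differentiable _ cL)).
by rewrite /= diff_lin.
Qed.

Lemma CkM k A (a b : V -> R) : open A ->
  Ck k A a -> Ck k A b -> Ck k A (fun x => a x * b x).
Proof.
move=> oA; elim: k a b => [|k IH] a b.
  by move=> ca cb x Ax; apply: cvgM; [exact: ca|exact: cb].
move=> Ca Cb; have [da Ca'] := Ca; have [db Cb'] := Cb.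
split=> [x Ax|v].
  exact: (differentiableM (da _ Ax) (db _ Ax)).
apply: Ck_ext (CkD oA (IH _ _ (CkS Ca) (Cb' v)) (IH _ _ (CkS Cb) (Ca' v))) => //.
move=> x Ax; rewrite (_ : (fun x => a x * b x) = a * b)//.
by rewrite diffM//; auto.
Qed.

Lemma Ck_prod k A (I : Type) (r : seq I) (F : I -> V -> R) : open A ->
  (forall i, Ck k A (F i)) -> Ck k A (fun x => \prod_(i <- r) F i x).
Proof.
move=> oA CF; elim: r => [|i r IH].
  by under eq_fun do rewrite big_nil; exact: Ck_cst.
by under eq_fun do rewrite big_cons; exact: CkM.
Qed.

Lemma CkV k A (a : V -> R) : open A -> (forall x, A x -> a x != 0) ->
  Ck k A a -> Ck k A (fun x => (a x)^-1).
Proof.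
move=> oA a0; elim: k => [|k IH].
  by move=> ca x Ax; apply: cvgV; [exact: a0|exact: ca].
move=> Ca; have [da Ca'] := Ca.
split=> [x Ax|v].
  exact: (differentiableV (da _ Ax) (a0 _ Ax)).
have Ci := IH (CkS Ca).
have Cm : Ck k A (fun _ : V => -1 : R) by exact: Ck_cst.
apply: Ck_ext (CkM oA (CkM oA Cm (CkM oA Ci Ci)) (Ca' v)) => //.
move=> x Ax; rewrite diffV//; auto.
by rewrite /= expr2 invfM mulN1r.
Qed.

Lemma Ck_scale {W : normedModType R} k A (a : V -> R) (w : W) : open A ->
  Ck k A a -> Ck k A (fun x => a x *: w).
Proof.
move=> oA Ca.
have lin : linear ( *:%R ^~ w : R -> W).
  by move=> u y z; rewrite scalerDl scalerA.
pose L : {linear R -> W} :=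
  HB.pack ( *:%R ^~ w : R -> W) (GRing.isLinear.Build _ _ _ _ _ lin).
have cL : continuous L by exact: scalel_continuous.
exact: (Ck_linear_comp (L := L) oA cL Ca).
Qed.

End Ck_products.

Section rV.
Context {R : realType}.

Lemma linear_rV_continuous n (W : normedModType R) (L : {linear 'rV[R]_n -> W}) :
  continuous L.
Proof.
move=> x; have LE y : L y = \sum_j y ord0 j *: L (delta_mx ord0 j).
  by rewrite {1}(row_sum_delta y) linear_sum; apply: eq_bigr => j _; rewrite linearZ.
rewrite (_ : (L : _ -> _) = fun y => \sum_j y ord0 j *: L (delta_mx ord0 j));
  last exact/funext.
have oT : open [set: 'rV[R]_n] := openT.
suff /(_ x I) : Ck 0 setT (fun y : 'rV[R]_n => \sum_j y ord0 j *: L (delta_mx ord0 j)).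
  by [].
apply: Ck_sum => //.
by move=> j; apply: Ck_scale => // y _; exact: coord_continuous.
Qed.

Lemma Ck_coord {V : normedModType R} n k (A : set V) (f : V -> 'rV[R]_n) i :
  open A -> Ck k A f -> Ck k A (fun x => f x ord0 i).
Proof.
move=> oA Cf.
have lin : linear (fun y : 'rV[R]_n => y ord0 i : R).
  by move=> a u v; rewrite !mxE.
pose L : {linear 'rV[R]_n -> R} :=
  HB.pack (fun y : 'rV[R]_n => y ord0 i : R) (GRing.isLinear.Build _ _ _ _ _ lin).
exact: (Ck_linear_comp (L := L) oA (@linear_rV_continuous _ _ L) Cf).
Qed.

Lemma Ck_row {V : normedModType R} n k (A : set V) (f : V -> 'rV[R]_n) :
  open A -> (forall i, Ck k A (fun x => f x ord0 i)) -> Ck k A f.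
Proof.
move=> oA Cf; apply: Ck_ext (Ck_sum (index_enum 'I_n)
   (F := fun i x => f x ord0 i *: delta_mx ord0 i) oA _) => //.
  by move=> x _; rewrite -row_sum_delta.
by move=> i; exact: Ck_scale.
Qed.

(** By the chain rule, the derivative of g \o f in the direction v is the sum over
    i of ('d f x v)_i times 'd g (f x) e_i. In each term the second factor is
    again a composite with f, of a map which is one degree less smooth than g;
    this is what the induction on k needs. Working with scalar g makes these
    terms products of scalar functions. *)
Let Ck_comp_scalar {V : normedModType R} n k (A : set V) (B : set 'rV[R]_n)
    (f : V -> 'rV[R]_n) (g : 'rV[R]_n -> R) :
  open A -> (forall x, A x -> B (f x)) ->
  Ck k A f -> Ck k B g -> Ck k A (fun x => g (f x)).
Proof.
move=> oA AB; elim: k g => [|k IH] g.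
  by move=> cf cg x Ax; apply: continuous_comp; [exact: cf|exact: cg (AB _ Ax)].
move=> Cf Cg; have [df Cf'] := Cf; have [dg Cg'] := Cg.
split=> [x Ax|v].
  exact: (differentiable_comp (df _ Ax) (dg _ (AB _ Ax))).
apply: Ck_ext (Ck_sum (index_enum 'I_n)
  (F := fun i x => 'd f x v ord0 i * 'd g (f x) (delta_mx ord0 i)) oA _) => //.
  move=> x Ax.
  have -> : 'd (fun x => g (f x)) x = 'd g (f x) \o 'd f x :> (V -> R).
    exact: (diff_comp (df _ Ax) (dg _ (AB _ Ax))).
  rewrite /= {2}(row_sum_delta ('d f x v)) linear_sum.
  by apply: eq_bigr => i _; rewrite linearZ.
move=> i; apply: CkM => //;
  last exact: (IH (fun y => 'd g y (delta_mx ord0 i)) (CkS Cf) (Cg' _)).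
exact: (Ck_coord (f := fun x => 'd f x v) i oA (Cf' v)).
Qed.

Lemma Ck_comp {V : normedModType R} n p k (A : set V) (B : set 'rV[R]_n)
    (f : V -> 'rV[R]_n) (g : 'rV[R]_n -> 'rV[R]_p) :
  open A -> open B -> (forall x, A x -> B (f x)) ->
  Ck k A f -> Ck k B g -> Ck k A (fun x => g (f x)).
Proof.
move=> oA oB AB Cf Cg; apply: Ck_row => // i.
by apply: (Ck_comp_scalar oA AB Cf (g := fun y => g y ord0 i)); exact: Ck_coord.
Qed.

(** The differential of j is the same map L at every point, so differentiating
    g \o j in the direction v amounts to differentiating g in the direction L v
    and the induction needs no product rule. *)
Lemma Ck_affine_comp {U V W : normedModType R} k (A : set V) (j : U -> V)
    (L : U -> V) (g : V -> W) :
  open A -> (forall x, is_diff x j L) -> Ck k A g ->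
  Ck k (j @^-1` A) (fun x => g (j x)).
Proof.
move=> oA dj.
have oB : open (j @^-1` A).
  apply: open_comp oA => x _; apply: differentiable_continuous.
  exact: ex_diff.
elim: k g => [|k IH] g.
  move=> cg x Ax; apply: continuous_comp; last exact: cg.
  by apply: differentiable_continuous; exact: ex_diff.
move=> [dg Cg]; split=> [x Ax|v].
  by apply: differentiable_comp; [exact: ex_diff|exact: dg].
apply: Ck_ext (IH (fun y => 'd g y (L v)) (Cg (L v))) => // x Ax.
have -> : 'd (fun x => g (j x)) x = 'd g (j x) \o 'd j x :> (U -> W).
  by apply: (diff_comp _ (dg _ Ax)); exact: ex_diff.
by rewrite /= diff_val.
Qed.

End rV.

(** * Mean value inequality and fixed points *)

Section rV_norm.
Context {R : realType} {n : nat}.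
Implicit Types v : 'rV[R]_n.

Lemma rV_norm_coord v i : `|v ord0 i| <= `|v|.
Proof.
by rewrite [leRHS]/Num.norm/= mx_normrE; exact: (le_bigmax _ _ (ord0, i)).
Qed.

Lemma rV_norm_le v c : 0 <= c -> (forall i, `|v ord0 i| <= c) -> `|v| <= c.
Proof.
move=> c0 vc; rewrite [leLHS]/Num.norm/= mx_normrE.
by apply/bigmax_leP; split => // -[i j] _ /=; rewrite (ord1 i).
Qed.

(** The crude factor n comes from bounding |v_j| by the sup norm for each j. *)
Lemma linear_rV_norm_le {W : normedModType R} (L : {linear 'rV[R]_n -> W}) c v :
  (forall j, `|L (delta_mx ord0 j)| <= c) -> `|L v| <= n%:R * c * `|v|.
Proof.
move=> Lc; rewrite {1}(row_sum_delta v) linear_sum.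
apply: (le_trans (ler_norm_sum _ _ _)).
have H j : true -> `|L (v ord0 j *: delta_mx ord0 j)| <= c * `|v|.
  rewrite linearZ normrZ mulrC => _.
  by apply: ler_pM => //; exact: rV_norm_coord.
apply: (le_trans (ler_sum _ H)).
by rewrite sumr_const card_ord -mulrA mulr_natl.
Qed.

Lemma linear_inj_unitmx (L : {linear 'rV[R]_n -> 'rV[R]_n}) :
  (forall v, L v = 0 -> v = 0) -> lin1_mx L \in unitmx.
Proof.
move=> L0; rewrite -row_free_unit; apply: inj_row_free => v.
by rewrite mul_rV_lin1 => /L0.
Qed.

Lemma linear_inj_inv (L : {linear 'rV[R]_n -> 'rV[R]_n}) :
  (forall v, L v = 0 -> v = 0) ->
  exists B : {linear 'rV[R]_n -> 'rV[R]_n}, cancel L B /\ cancel B L.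
Proof.
move=> /linear_inj_unitmx Lu; exists (mulmxr (invmx (lin1_mx L))).
by split=> v; rewrite /= -mul_rV_lin1 ?mulmxK ?mulmxKV.
Qed.

End rV_norm.

HB.instance Definition _ (R : realType) n :=
  Uniform_isComplete.Build 'rV[R]_n cauchy_cvg.

Lemma contraction_fixed_point {R : realType} {X : completeNormedModType R}
    (D : set X) (T : X -> X) (q : {nonneg R}) :
  closed D -> D !=set0 -> (forall x, D x -> D (T x)) -> q%:num < 1 ->
  (forall x y, D x -> D y -> `|T x - T y| <= q%:num * `|x - y|) ->
  exists2 x, D x & T x = x.
Proof.
move=> cD D0 DT q1 Tq.
pose F : {fun D >-> D} := HB.pack T (isFun.Build _ _ D D T DT).
have ctr : is_contraction F.
  by exists q; split=> // -[x y] /= [Dx Dy]; exact: Tq.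
by have [p Dp pE] := banach_fixed_point ctr cD D0; exists p.
Qed.

Lemma ball_segment {R : realType} {V : normedModType R} (a x y : V) (r t : R) :
  0 <= t <= 1 -> ball a r x -> ball a r y -> ball a r (y + t *: (x - y)).
Proof.
move=> /andP[t0 t1]; rewrite -!ball_normE /= => ax ay.
have -> : a - (y + t *: (x - y)) = (1 - t) *: (a - y) + t *: (a - x).
  rewrite scalerBl scale1r -addrA (addrC (- _)) -scalerBr opprB.
  by rewrite (addrC (a - x)) subrKA opprD addrA -scalerN opprB.
pose M := Num.max `|a - x| `|a - y|.
have Mr : M < r by rewrite gt_max ax ay.
apply: le_lt_trans Mr; apply: (le_trans (ler_normD _ _)).
rewrite !normrZ (ger0_norm t0) ger0_norm ?subr_ge0//.
have -> : M = (1 - t) * M + t * M by rewrite -mulrDl subrK mul1r.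
by apply: lerD; rewrite ler_wpM2l ?subr_ge0// le_max lexx ?orbT.
Qed.

(** The scalar mean value theorem is applied to each coordinate of h along the
    segment from y to x. The sup norm lets the coordinates use different
    intermediate points. *)
Lemma mean_value_inequality {R : realType} {V : normedModType R} {p : nat}
    (h : V -> 'rV[R]_p) (a : V) (r q : R) : 0 <= q ->
  (forall x, ball a r x -> differentiable h x) ->
  (forall x v, ball a r x -> `|'d h x v| <= q * `|v|) ->
  forall x y, ball a r x -> ball a r y -> `|h x - h y| <= q * `|x - y|.
Proof.
move=> q0 dh hq x y ax ay; apply: rV_norm_le; first by rewrite mulr_ge0.
move=> i; pose j (t : R) : V := y + t *: (x - y).
have jball t : 0 <= t <= 1 -> ball a r (j t) by move=> t01; exact: ball_segment.
have dj (t : R) : is_diff t j (fun s => s *: (x - y)).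
  rewrite (_ : j = cst y + (fun s : R => s *: (x - y)))//.
  by apply: is_diff_eq; rewrite add0r.
have dphi (t : R) : 0 <= t <= 1 ->
    is_derive t 1 (fun s => h (j s) ord0 i : R) ('d h (j t) (x - y) ord0 i).
  move=> t01; have dhj : differentiable (h \o j) t.
    by apply: differentiable_comp; [exact: ex_diff|exact: dh (jball _ t01)].
  have dD : derivable (h \o j) t 1 by exact: diff_derivable.
  have dDi := (derivable_mxP _ _ _).1 dD ord0 i.
  apply: DeriveDef; first exact: dDi.
  have := derive_mx dD => /rowP/(_ i); rewrite mxE => <-.
  rewrite deriveE//.
  have -> : 'd (h \o j) t = 'd h (j t) \o 'd j t :> (R -> 'rV[R]_p).
    by apply: diff_comp; [exact: ex_diff|exact: dh (jball _ t01)].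
  by rewrite /= diff_val scale1r.
have [||c c01] := @MVT_segment R (fun s => h (j s) ord0 i)
  (fun t => 'd h (j t) (x - y) ord0 i) 0 1 ler01.
- by move=> t; rewrite in_itv /= => /andP[t0 t1]; apply: dphi; rewrite !ltW.
- apply: derivable_within_continuous => t; rewrite in_itv /= => t01.
  exact: (@ex_derive _ _ _ _ _ _ _ (dphi t t01)).
rewrite subr0 mulr1 /j scale1r scale0r addr0 subrKC !mxE => ->.
apply: (le_trans (rV_norm_coord _ _)); apply: hq; apply: jball.
by move: c01; rewrite in_itv.
Qed.

(** * Local inversion *)

(** Local form of the inverse function theorem. The map h x = x - B (f x), with
    B the inverse of 'd f a, has zero differential at a, hence is 1/2-Lipschitz
    on a small ball. Writing x - y = (h x - h y) + B (f x - f y) yields the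
    lower bound for |f x - f y|, and f x = y means that x is a fixed point of
    the contraction x |-> h x + B y. Letting the ball radius e vary records
    that the solution depends continuously on y at f a. *)
Lemma local_inverse {R : realType} {n : nat} (U : set 'rV[R]_n)
    (f : 'rV[R]_n -> 'rV[R]_n) (a : 'rV[R]_n) :
  open U -> U a -> Ck 1 U f -> (forall v, 'd f a v = 0 -> v = 0) ->
  exists C r : R, [/\ 0 < C, 0 < r, ball a r `<=` U,
    forall x y, ball a r x -> ball a r y -> `|x - y| <= C * `|f x - f y| &
    forall e, 0 < e -> e <= r -> exists2 d, 0 < d &
      forall y, ball (f a) d y -> exists2 x, ball a e x & f x = y].
Proof.
move=> oU Ua [df cdf] inj.
have [B [BE BE']] := linear_inj_inv inj.
have cB : continuous B by exact: linear_rV_continuous.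
have [K K0 BK] := linear_lipschitz cB.
pose h x := x - B (f x).
have dh x : U x -> differentiable h x /\ forall v, 'd h x v = v - B ('d f x v).
  move=> Ux.
  have dBf : is_diff x (B \o f) (B \o 'd f x).
    apply: is_diff_comp; first exact: differentiableP (df _ Ux).
    by apply: DiffDef; [exact: linear_differentiable|rewrite diff_lin].
  have dh' : is_diff x h (id - (B \o 'd f x)) by exact: is_diffB.
  by case: dh' => dh' dhE; split; [exact: dh'|move=> v; exact: (congr1 (@^~ v) dhE)].
(* K * n * eta <= 1/2, where n is the constant of linear_rV_norm_le; the
   successor keeps eta finite for n = 0. *)
pose eta := (2 * K * n.+1%:R)^-1.
have eta0 : 0 < eta by rewrite invr_gt0 !mulr_gt0.
have dfnear : \forall x \near a, U x /\ forall j : 'I_n,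
    `|'d f a (delta_mx ord0 j) - 'd f x (delta_mx ord0 j)| <= eta.
  near=> x; split; first by near: x; exact: open_nbhs_nbhs.
  near: x; apply: filter_forall => j.
  by have /cvgrPdist_le := cdf (delta_mx ord0 j) a Ua; apply.
have /nbhs_ballP[r /= r0 ballr] := dfnear.
have bU : ball a r `<=` U by move=> x /ballr[].
have dhle x v : ball a r x -> `|'d h x v| <= 2^-1 * `|v|.
  move=> /ballr[Ux dfx]; rewrite (dh _ Ux).2 -{1}(BE v) -linearB.
  apply: (le_trans (BK _)).
  pose L : {linear 'rV[R]_n -> 'rV[R]_n} := 'd f a \- 'd f x.
  have /= := linear_rV_norm_le (L := L) v dfx.
  move=> /(ler_wpM2l (ltW K0)) /le_trans; apply.
  rewrite !mulrA ler_wpM2r// /eta.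
  rewrite ler_pdivrMr ?mulr_gt0// !mulrA mulVf// mul1r ler_wpM2l ?ltW//.
  by rewrite ltr_nat.
have hlip := mean_value_inequality (h := h) (a := a) (r := r) (q := 2^-1).
have {}hlip x y : ball a r x -> ball a r y -> `|h x - h y| <= 2^-1 * `|x - y|.
  by apply: hlip; [rewrite invr_ge0|move=> z /bU /dh[]|exact: dhle].
exists (2 * K), r; split => //; first by rewrite mulr_gt0.
- move=> x y ax ay; have hxy := hlip _ _ ax ay.
  have : `|x - y| <= `|h x - h y| + K * `|f x - f y|.
    have -> : x - y = (h x - h y) + B (f x - f y).
      by rewrite /h (linearB B); apply/rowP => i; rewrite !mxE; ring.
    by apply: (le_trans (ler_normD _ _)); rewrite lerD2l.
  clear - hxy => hxy'; lra.
(* On the closed ball of radius e / 2, T takes values within e / 4 + K * d of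
   the centre a, and this d makes K * d equal to e / 4. *)
- move=> e e0 er; exists (e / (4 * K)); first by rewrite divr_gt0 ?mulr_gt0.
  move=> y; rewrite -ball_normE /= distrC => yd.
  pose T x := h x + B y.
  pose D := closed_ball a (e / 2).
  have e2 : 0 < e / 2 by rewrite divr_gt0.
  have DE x : D x <-> `|a - x| <= e / 2 by rewrite /D closed_ballE.
  have Dr x : D x -> ball a e x.
    move=> /DE; rewrite -ball_normE /= => ax; apply: le_lt_trans ax _.
    by clear - e0; lra.
  have Dr' x : D x -> ball a r x by move=> /Dr; apply: le_ball.
  have aa : ball a r a by exact: ballxx.
  have [||x Dx||x z Dx Dz|x Dx Tx] :=
    @contraction_fixed_point R 'rV[R]_n D T (2^-1)%:nng.
  + exact: closed_ball_closed.
  + by exists a; apply/DE; rewrite subrr normr0 ltW.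
  + apply/DE.
    have -> : a - T x = (h a - h x) - B (y - f a).
      by rewrite /T /h (linearB B); apply/rowP => i; rewrite !mxE; ring.
    apply: (le_trans (ler_normB _ _)).
    have h1 := hlip _ _ aa (Dr' _ Dx).
    have h2 := BK (y - f a).
    have h3 : K * `|y - f a| <= e / 4.
      by rewrite mulrC -ler_pdivlMr// (le_trans (ltW yd))// invfM mulrA.
    move/DE : Dx; clear - h1 h2 h3 => h4; lra.
  + by rewrite /=; clear; lra.
  + by rewrite /T opprD addrACA subrr addr0; apply: hlip; exact: Dr'.
  + exists x; first by move/Dr: Dx; rewrite -ball_normE.
    apply/eqP; rewrite -subr_eq0 -(BE' (f x - y)) (linearB B); apply/eqP.
    have -> : B (f x) - B y = x - T x.
      by rewrite /T /h; apply/rowP => i; rewrite !mxE; ring.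
    by rewrite Tx subrr linear0.
Unshelve. all: by end_near. Qed.

(** * Smoothness of inverse maps *)

Section Ck_inverse.
Context {R : realType}.

Lemma Ck_det {V : normedModType R} n k (A : set V) (M : V -> 'M[R]_n) :
  open A -> (forall i j, Ck k A (fun x => M x i j)) ->
  Ck k A (fun x => \det (M x)).
Proof.
move=> oA CM; apply: Ck_sum => // s; apply: CkM => //; first exact: Ck_cst.
exact: Ck_prod.
Qed.

(** The entries of an inverse matrix are cofactors divided by the determinant. *)
Lemma Ck_mul_invmx {V : normedModType R} n k (A : set V) (M : V -> 'M[R]_n)
    (v : 'rV[R]_n) : open A ->
  (forall x, A x -> M x \in unitmx) -> (forall i j, Ck k A (fun x => M x i j)) ->
  Ck k A (fun x => v *m invmx (M x)).
Proof.
move=> oA Mu CM; apply: Ck_row => // i.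
have Cd : Ck k A (fun x => (\det (M x))^-1).
  apply: CkV => //; last exact: Ck_det.
  by move=> x /Mu; rewrite unitmxE unitfE.
apply: Ck_ext (Ck_sum (index_enum 'I_n) (F := fun j x =>
  v ord0 j * ((\det (M x))^-1 * cofactor (M x) i j)) oA _) => //.
  move=> x Ax; rewrite mxE; apply: eq_bigr => j _.
  by rewrite /invmx Mu// !mxE.
move=> j; apply: CkM => //; first exact: Ck_cst.
apply: CkM => //; apply: CkM => //; first exact: Ck_cst.
by apply: Ck_det => // p q; under eq_fun do rewrite !mxE; exact: CM.
Qed.

(** If 'd f x v = 0, then f (x + t v) - f x is o(t), which the lower bound forbids
    unless v = 0. *)
Lemma diff_inj_of_expanding {V W : normedModType R} (f : V -> W) (x : V) (C : R) :
  0 < C -> differentiable f x ->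
  (\forall y \near x, `|y - x| <= C * `|f y - f x|) ->
  forall v, 'd f x v = 0 -> v = 0.
Proof.
move=> C0 df exp v dv0; apply/eqP/negP => /negP v0.
have e0 : 0 < (2 * C)^-1 by rewrite invr_gt0 mulr_gt0.
have /nbhs_ballP[r /= r0 H] : \forall y \near x, `|y - x| <= C * `|f y - f x| /\
    `|f y - f x - 'd f x (y - x)| <= (2 * C)^-1 * `|y - x|.
  exact: filterI exp (diff_approx df e0).
pose t := r / (2 * `|v|).
have vp : 0 < `|v| by rewrite normr_gt0.
have t0 : 0 < t by rewrite divr_gt0 ?mulr_gt0.
have tv : `|t *: v| = r / 2.
  by rewrite normrZ gtr0_norm// /t invfM mulrA divfK ?gt_eqF.
have [] := H (x + t *: v).
  by rewrite -ball_normE /= opprD addNKr normrN tv ltr_pdivrMr// ltr_pMr// ltr1n.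
rewrite addrC addKr linearZ/= dv0 scaler0 subr0 tv => h1 h2.
have := le_trans h1 (ler_wpM2l (ltW C0) h2).
rewrite mulrA invfM (mulrCA C) mulfV ?gt_eqF// mulr1; clear - r0 => h3; lra.
Qed.

Lemma lipschitz_continuous_at {V W : normedModType R} (g : V -> W) (y : V) (C : R) :
  0 < C -> (\forall z \near y, `|g y - g z| <= C * `|y - z|) ->
  {for y, continuous g}.
Proof.
move=> C0 gC; apply/(@cvgrPdist_le _ _ _ (nbhs y)) => e e0.
near=> z; apply: (@le_trans _ _ (C * `|y - z|)); first by near: z.
rewrite -ler_pdivlMl//; near: z.
have /cvgrPdist_le := @cvg_id _ (nbhs y); apply.
by rewrite mulr_gt0 ?invr_gt0.
Unshelve. all: by end_near. Qed.

(** The lower bound makes g Lipschitz and the differential of f injective on all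
    of A. Up to sign, the error term of g at y is the image under ('d f (g y))^-1 of the error
    term of f at g y, so that g is differentiable with 'd g y = ('d f (g y))^-1.
    In this formula a C^k map g on the right yields a C^k differential, whence
    the induction on k. *)
Lemma smooth_inverse n (A B : set 'rV[R]_n) (f g : 'rV[R]_n -> 'rV[R]_n) (C : R) :
  open A -> open B -> 0 < C -> smooth_on A f ->
  (forall x y, A x -> A y -> `|x - y| <= C * `|f x - f y|) ->
  (forall y, B y -> A (g y) /\ f (g y) = y) ->
  smooth_on B g.
Proof.
move=> oA oB C0 sf exp gK.
have [df _] := sf 1%N.
have inj x : A x -> forall v, 'd f x v = 0 -> v = 0.
  move=> Ax; apply: diff_inj_of_expanding C0 (df _ Ax) _.
  by apply: filterS (open_nbhs_nbhs (conj oA Ax)) => y Ay; exact: exp.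
have glip y z : B y -> B z -> `|g y - g z| <= C * `|y - z|.
  by move=> /gK[Ay {2}<-] /gK[Az {2}<-]; exact: exp.
have cg y : B y -> {for y, continuous g}.
  move=> By; apply: lipschitz_continuous_at C0 _.
  by apply: filterS (open_nbhs_nbhs (conj oB By)) => z Bz; exact: glip.
have dg y : B y -> differentiable g y /\
    forall v, 'd g y v = v *m invmx (lin1_mx ('d f (g y))).
  move=> By; have [Ax fx] := gK _ By.
  have [L [LK KL]] := linear_inj_inv (inj _ Ax).
  have [K K0 LK'] := linear_lipschitz (@linear_rV_continuous _ _ _ L).
  have [||dgy dgE] := @diff_of_approx R 'rV[R]_n 'rV[R]_n g y L.
  - exact: linear_rV_continuous.
  - move=> e e0.
    have e'0 : 0 < e / (K * C) by rewrite divr_gt0 ?mulr_gt0.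
    have fz0 := cg _ By _ (diff_approx (df _ Ax) e'0).
    apply: filterS2 (open_nbhs_nbhs (conj oB By)) fz0 => z Bz /= h1.
    have [Az fz] := gK _ Bz.
    have -> : g z - g y - L (z - y) =
        - L (f (g z) - f (g y) - 'd f (g y) (g z - g y)).
      by rewrite fz fx [in RHS](linearB L) LK opprB.
    rewrite normrN; apply: (le_trans (LK' _)).
    have h2 := glip _ _ Bz By.
    have := le_trans h1 (ler_wpM2l (ltW e'0) h2).
    move=> /(ler_wpM2l (ltW K0)) /le_trans; apply.
    suff -> : K * (e / (K * C) * (C * `|z - y|)) = e * `|z - y| by [].
    by field; rewrite !gt_eqF.
  - split; [exact: dgy|move=> v].
    have -> : 'd g y v = L v := congr1 (@^~ v) dgE.
    have u := linear_inj_unitmx (inj _ Ax).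
    have E : v = L v *m lin1_mx ('d f (g y)) by rewrite mul_rV_lin1 KL.
    by rewrite {2}E mulmxK.
elim=> [//|k IH]; split=> [y /dg[]//|v].
apply: Ck_ext (Ck_comp (A := B) (B := A)
  (g := fun x => v *m invmx (lin1_mx ('d f x))) oB oA _ IH _) => //.
- by move=> y /dg[].
- by move=> y /gK[].
- apply: Ck_mul_invmx => // [x Ax|i j]; first exact: linear_inj_unitmx (inj _ Ax).
  under eq_fun do rewrite mxE; apply: Ck_coord => //.
  by have [_ ] := sf k.+1; apply.
Qed.

End Ck_inverse.

(** * Smooth maps between manifolds and the chain rule *)

Section charts.
Context {R : realType} {n : nat} {M : manifoldType R n}.
Implicit Types (p q : M).

Lemma coordK p q : chart_dom (chart_at p) q -> param p (coord p q) = q.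
Proof. by move=> pq; rewrite /param /coord chart_mapK// inE. Qed.

Lemma coordK_id p : param p (coord p p) = p.
Proof. by apply: coordK; exact: chart_at_dom. Qed.

Lemma chart_dom_near p : \forall q \near p, chart_dom (chart_at p) q.
Proof.
by apply: open_nbhs_nbhs; split; [exact: chart_dom_open|exact: chart_at_dom].
Qed.

Lemma coord_continuous_at p q : chart_dom (chart_at p) q ->
  {for q, continuous (coord p)}.
Proof. exact: chart_map_continuous. Qed.

Lemma param_continuous_at p : {for coord p p, continuous (param p)}.
Proof.
by apply: chart_inv_continuous; exists p => //; exact: chart_at_dom.
Qed.

Lemma paramK_near p : \forall y \near coord p p,
  chart_dom (chart_at p) (param p y) /\ coord p (param p y) = y.
Proof.
have : nbhs (coord p p) (chart_map (chart_at p) @` chart_dom (chart_at p)).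
  apply: open_nbhs_nbhs; split; first exact: chart_img_open.
  by exists p => //; exact: chart_at_dom.
apply: filterS => y [q pq <-].
by rewrite (_ : param p _ = q)//; exact: coordK.
Qed.

End charts.

Lemma near_open {T : topologicalType} (x : T) (P : T -> Prop) :
  (\forall y \near x, P y) ->
  exists B : set T, [/\ open B, B x & forall y, B y -> P y].
Proof.
by move=> h; have : nbhs x [set y | P y] by []; rewrite nbhsE => -[B []]; exists B.
Qed.

Section smooth_near.
Context {R : realType} {V W : normedModType R}.
Implicit Types f g : V -> W.

Lemma smooth_near_differentiable f x : smooth_near f x -> differentiable f x.
Proof. by move=> [U [oU Ux /(_ 1%N)[df _]]]; exact: df. Qed.

Lemma near_eq_smooth_near f g x : (\forall y \near x, f y = g y) ->
  smooth_near f x -> smooth_near g x.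
Proof.
move=> /near_open[B [oB Bx Bfg]] [U [oU Ux sf]].
exists (U `&` B); split => //; first exact: openI.
by move=> k; apply: Ck_ext (Ck_subset (@subIsetl _ _ _) (sf k));
  [exact: openI|move=> y [_ /Bfg]].
Qed.

End smooth_near.

Lemma smooth_near_comp {R : realType} {V : normedModType R} n p
    (f : V -> 'rV[R]_n) (g : 'rV[R]_n -> 'rV[R]_p) x :
  smooth_near f x -> smooth_near g (f x) -> smooth_near (g \o f) x.
Proof.
move=> sf [B [oB Bx sg]].
have cf := differentiable_continuous (smooth_near_differentiable sf).
have [A [oA Ax {}sf]] := sf.
have /near_open[D [oD Dx DAB]] : nbhs x (A `&` f @^-1` B).
  apply: filterI; first exact: open_nbhs_nbhs.
  by apply: cf; exact: open_nbhs_nbhs.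
exists D; split => // k.
apply: (Ck_comp (A := D) (B := B) oD oB _ _ (sg k)); first by move=> y /DAB[].
by apply: Ck_subset (sf k) => y /DAB[].
Qed.

Lemma near_eq_continuous_at {T U : topologicalType} (f g : T -> U) x :
  (\forall y \near x, f y = g y) -> {for x, continuous f} ->
  {for x, continuous g}.
Proof.
move=> fg; rewrite /prop_for /continuous_at -(nbhs_singleton fg).
by apply: cvg_trans; apply: near_eq_cvg; apply: filterS fg => y ->.
Qed.

Lemma near_eq_vsmooth_at {R : realType} {V : normedModType R} {n : nat}
    {M : manifoldType R n} (f g : V -> M) x : (\forall y \near x, f y = g y) ->
  vsmooth_at f x -> vsmooth_at g x.
Proof.
move=> fg [cf sf]; split; first exact: near_eq_continuous_at cf.
rewrite -(nbhs_singleton fg); apply: near_eq_smooth_near sf.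
by apply: filterS fg => y /= ->.
Qed.

Section vsmooth.
Context {R : realType} {V : normedModType R} {m n : nat}.
Context {M : manifoldType R m} {N : manifoldType R n}.

(** Continuity of f at x is enough to read F \o f in the single chart around f x
    for all points near x. *)
Lemma comp_local (f : V -> M) (F : M -> N) x : {for x, continuous f} ->
  \forall y \near x,
    F (f y) = (F \o param (f x)) (coord (f x) (f y)).
Proof.
move=> cf.
have H : \forall y \near x, chart_dom (chart_at (f x)) (f y).
  exact: cf _ (chart_dom_near (f x)).
by apply: filterS H => y /= fy; rewrite coordK.
Qed.

Lemma vsmooth_at_comp (f : V -> M) (F : M -> N) x :
  vsmooth_at f x -> smooth_at F (f x) -> vsmooth_at (F \o f) x.
Proof.
move=> [cf sf] [cF sF].
suff H : vsmooth_at ((F \o param (f x)) \o (coord (f x) \o f)) x.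
  by apply: near_eq_vsmooth_at H; apply: filterS (comp_local F cf) => y /= ->.
split.
  apply: continuous_comp; last exact: cF.
  by apply: continuous_comp => //; apply: coord_continuous_at; exact: chart_at_dom.
exact: (smooth_near_comp sf sF).
Qed.

(** As velocities and tangent maps are both instances of this differential, the
    chain rule is only needed once. *)
Definition vtangent (f : V -> M) (x : V) : V -> 'rV[R]_m := 'd (coord (f x) \o f) x.

End vsmooth.

Section chain_rule.
Context {R : realType} {V : normedModType R} {m n : nat}.
Context {M : manifoldType R m} {N : manifoldType R n}.

Lemma vtangent_comp (f : V -> M) (F : M -> N) x :
  vsmooth_at f x -> smooth_at F (f x) ->
  vtangent (F \o f) x = tangent_map F (f x) \o vtangent f x.
Proof.
move=> [cf sf] [cF sF].
have dF := smooth_near_differentiable sF; rewrite /= coordK_id in dF.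
have df := smooth_near_differentiable sf.
have dG := differentiable_comp df dF.
have [|_ E] := near_eq_diff (g := coord (F (f x)) \o (F \o f)) _ dG.
  by apply: filterS (comp_local F cf) => y /= ->.
by rewrite /vtangent /tangent_map E (diff_comp df dF).
Qed.

End chain_rule.

Section smooth_at.
Context {R : realType} {m n : nat} {M : manifoldType R m} {N : manifoldType R n}.

Lemma near_eq_smooth_at (F G : M -> N) p : (\forall q \near p, F q = G q) ->
  smooth_at F p -> smooth_at G p.
Proof.
move=> FG; apply: near_eq_vsmooth_at.
have := @param_continuous_at _ _ _ p; rewrite /prop_for /continuous_at coordK_id.
by move=> /(_ _ FG).
Qed.

Lemma tangent_mapE (F : M -> N) p :
  tangent_map F p = vtangent (F \o param p) (coord p p).
Proof. by rewrite /tangent_map /vtangent /= coordK_id. Qed.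

Lemma tangent_map_id (p : M) v : tangent_map id p v = v.
Proof.
rewrite /tangent_map.
have [||_ E] := @near_eq_diff _ _ _ id (coord p \o id \o param p) (coord p p).
- have H := paramK_near p.
  by apply: filterS H => y [].
- exact: ex_diff.
- by have -> : 'd (coord p \o id \o param p) (coord p p) v = 'd id (coord p p) v
    := congr1 (@^~ v) E; rewrite diff_val.
Qed.

End smooth_at.

Section smooth_at_comp.
Context {R : realType} {m n k : nat} {M : manifoldType R m}.
Context {N : manifoldType R n} {P : manifoldType R k}.

Lemma smooth_at_comp (F : M -> N) (G : N -> P) p :
  smooth_at F p -> smooth_at G (F p) -> smooth_at (G \o F) p.
Proof.
move=> sF sG; apply: (vsmooth_at_comp (f := F \o param p)) => //=.
by rewrite coordK_id.
Qed.

Lemma tangent_map_comp (F : M -> N) (G : N -> P) p :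
  smooth_at F p -> smooth_at G (F p) ->
  tangent_map (G \o F) p = tangent_map G (F p) \o tangent_map F p.
Proof.
move=> sF sG; have E : (F \o param p) (coord p p) = F p by rewrite /= coordK_id.
have sG' : smooth_at G ((F \o param p) (coord p p)) by rewrite E.
transitivity (vtangent (G \o (F \o param p)) (coord p p)).
  exact: tangent_mapE.
apply: etrans (vtangent_comp sF sG') _.
exact: (f_equal2 (fun q L => tangent_map G q \o L) E (esym (tangent_mapE F p))).
Qed.

End smooth_at_comp.

Section inverse.
Context {R : realType} {n : nat} {M N : manifoldType R n}.

(** In charts, local_inverse provides for every y near F p a solution x near p of
    F x = y. Since G is a left inverse of F, this x is G y; so G is continuous at
    F p and given near F p by the local inverse. *)
Lemma smooth_at_inverse (F : M -> N) (G : N -> M) p :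
  cancel F G -> smooth_at F p ->
  (forall v, tangent_map F p v = 0 -> v = 0) -> smooth_at G (F p).
Proof.
move=> FK [cF sF] inj; rewrite /= coordK_id in sF.
set f := coord (F p) \o (F \o param p) in sF.
set a := coord p p in cF sF.
have [U [oU Ua sf]] := sF.
have [C [r [C0 r0 bU exp surj]]] := local_inverse oU Ua (sf 1%N) inj.
have Fpa : (F \o param p) a = F p by rewrite /= coordK_id.
have Q : nbhs a [set x | (chart_dom (chart_at (F p)) (F (param p x))) /\
    (chart_dom (chart_at p) (param p x) /\ coord p (param p x) = x)].
  apply: filterI; last exact: paramK_near.
  by move: cF; rewrite /prop_for /continuous_at Fpa; apply; exact: chart_dom_near.
have [s /= s0 bQ] := (nbhs_ballP _ _).1 Q.
pose e := Num.min r s.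
have e0 : 0 < e by rewrite lt_min r0 s0.
have er : e <= r by rewrite ge_min lexx.
have es : e <= s by rewrite ge_min lexx orbT.
have {}bQ x : ball a e x -> _ := fun ae => bQ x (le_ball es ae).
have {}exp x y : ball a e x -> ball a e y -> `|x - y| <= C * `|f x - f y|.
  by move=> ax ay; apply: exp; exact: (le_ball er).
have [d d0 {}surj] := surj _ e0 er.
pose g := coord p \o (G \o param (F p)).
have fa : f a = coord (F p) (F p) by rewrite /f /= coordK_id.
rewrite fa in surj.
have [D [oD Db bD]] := near_open (paramK_near (F p)).
set b := coord (F p) (F p) in surj Db.
pose B := ball b d `&` D.
have oB : open B by apply: openI => //; exact: ball_open.
have Bb : B b by split => //; exact: ballxx.
have BE y : B y -> [/\ ball a e (g y), f (g y) = y & G (param (F p) y) = param p (g y)].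
  move=> [/surj[x ax fx] /bD[qy qyK]].
  have [Fx [px pxK]] := bQ _ ax.
  have Fxy : F (param p x) = param (F p) y by rewrite -(coordK Fx) -fx.
  have Gy : G (param (F p) y) = param p x by rewrite -Fxy FK.
  by have -> : g y = x by rewrite /g /= Gy.
have sg : smooth_on B g.
  apply: (@smooth_inverse R n (ball a e) B f g C) => //.
  - exact: ball_open.
  - by move=> k; apply: Ck_subset (sf k) => x ax; apply/bU/(le_ball er).
  - by move=> y /BE[].
have gb : g b = a by rewrite /g /= coordK_id FK.
split; last first.
  by rewrite /= coordK_id FK; exists B.
have cg : {for b, continuous g} := sg 0%N b Bb.
apply: (near_eq_continuous_at (f := param p \o g)).
  have Bn := open_nbhs_nbhs (conj oB Bb).
  by apply: filterS Bn => y /BE[_ _ /= ->].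
apply: continuous_comp => //.
by rewrite gb; exact: param_continuous_at.
Qed.

End inverse.

(** * Curves and their velocities *)

Section affine_reparametrization.
Context {R : realType}.

Lemma vsmooth_at_affine {U V : normedModType R} {n} {N : manifoldType R n}
    (j L : U -> V) (f : V -> N) x :
  (forall y, is_diff y j L) -> vsmooth_at f (j x) -> vsmooth_at (f \o j) x.
Proof.
move=> dj [cf [A [oA Ax sf]]].
have cj y : {for y, continuous j} by apply: differentiable_continuous; exact: ex_diff.
split; first exact: continuous_comp.
exists (j @^-1` A); split => //; last by move=> k; exact: Ck_affine_comp dj (sf k).
by apply: open_comp oA => y _; exact: cj.
Qed.

Context {m n k : nat} {M : manifoldType R m} {N : manifoldType R n}.
Context {P : manifoldType R k}.

(** A partial application is the composite with the affine map y |-> (p, y). *)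
Lemma smooth2_at_left (f : M -> N -> P) p q :
  smooth2_at f p q -> smooth_at (f p) q.
Proof.
move=> sf; rewrite /smooth_at.
rewrite (_ : f p \o param q = (fun z : 'rV[R]_m * 'rV[R]_n =>
  f (param p z.1) (param q z.2)) \o (fun y => (coord p p, y))); last first.
  by apply/funext => y /=; rewrite coordK_id.
by apply: (@vsmooth_at_affine _ _ _ _ _ (fun y => (0, y))).
Qed.

Lemma smooth2_at_right (f : M -> N -> P) p q :
  smooth2_at f p q -> smooth_at (f^~ q) p.
Proof.
move=> sf; rewrite /smooth_at.
rewrite (_ : f^~ q \o param p = (fun z : 'rV[R]_m * 'rV[R]_n =>
  f (param p z.1) (param q z.2)) \o (fun y => (y, coord q q))); last first.
  by apply/funext => y /=; rewrite coordK_id.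
by apply: (@vsmooth_at_affine _ _ _ _ _ (fun y => (y, 0))).
Qed.

(** Freezing a point q of B, the local smooth extension agrees with f near p,
    because A is open. *)
Lemma smooth2_on_right (A : set M) (B : set N) (f : M -> N -> P) p q :
  open A -> A p -> B q -> smooth2_on A B f -> smooth_at (f^~ q) p.
Proof.
move=> oA Ap Bq /(_ p q Ap Bq)[U [V [F [[oU Up] [oV Vq] sF Ff]]]].
have /smooth2_at_right := sF _ _ Up Vq.
apply: near_eq_smooth_at.
have : nbhs p (U `&` A) by apply: filterI; exact: open_nbhs_nbhs.
by apply: filterS => x UAx; apply: Ff.
Qed.

End affine_reparametrization.

(** R^o is R as a normed space over itself, the domain of curves. *)
Local Notation smooth_curve_at c t := (@vsmooth_at _ (_^o) _ _ c t).

Section velocity.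
Context {R : realType} {m : nat} {M : manifoldType R m}.
Implicit Types (c : R -> M) (t : R).

Lemma eq_velocity c c' t : c =1 c' -> velocity c t = velocity c' t.
Proof. by move=> /funext ->. Qed.

Lemma near_eq_velocity c c' t : (\forall s \near t, c s = c' s) ->
  velocity c t = velocity c' t.
Proof.
move=> cc'; rewrite /velocity !derive1E (nbhs_singleton cc').
by apply: near_eq_derive; apply: filterS cc' => s /= ->.
Qed.

Lemma velocityE c t : smooth_curve_at c t ->
  velocity c t = vtangent (c : R^o -> M) t 1.
Proof. by move=> [_ /smooth_near_differentiable dc]; exact: derive1E'. Qed.

Lemma affine_is_diff (alpha beta s : R^o) :
  is_diff s ((fun t => alpha * t + beta) : R^o -> R^o) (fun t => alpha * t).
Proof.
rewrite (_ : (fun t => _) = ( *:%R alpha : R^o -> R^o) + cst beta)//.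
by apply: is_diff_eq; rewrite addr0.
Qed.

Lemma smooth_curve_affine c alpha beta t : smooth_curve_at c (alpha * t + beta) ->
  smooth_curve_at (fun s => c (alpha * s + beta)) t.
Proof.
by move=> sc; apply: (vsmooth_at_affine (affine_is_diff alpha beta)).
Qed.

Lemma velocity_affine c alpha beta t : smooth_curve_at c (alpha * t + beta) ->
  velocity (fun s => c (alpha * s + beta)) t =
  alpha *: velocity c (alpha * t + beta).
Proof.
move=> sc; rewrite velocityE; last exact: smooth_curve_affine.
rewrite velocityE// /vtangent.
have dc := smooth_near_differentiable sc.2.
have [dj djE] := affine_is_diff alpha beta t.
have E := @diff_comp R R^o R^o 'rV[R]_m _ _ _ dj dc.
apply: etrans (congr1 (@^~ 1) E) _.
apply: etrans (congr1 _ (congr1 (@^~ 1) djE)) _.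
exact: (linearZ_LR _ alpha (1 : R^o)).
Qed.

End velocity.

Lemma velocity_comp {R : realType} {m n : nat} {M : manifoldType R m}
    {N : manifoldType R n} (c : R -> M) (F : M -> N) t : smooth_curve_at c t ->
  smooth_at F (c t) -> velocity (F \o c) t = tangent_map F (c t) (velocity c t).
Proof.
move=> sc sF; have sFc : smooth_curve_at (F \o c) t := vsmooth_at_comp sc sF.
by rewrite velocityE// (vtangent_comp sc sF) velocityE.
Qed.

(** * Piecewise smooth curves *)

Section piecewise.
Context {R : realType} {n : nat} {M : manifoldType R n}.
Implicit Types (c : R -> M) (a b t : R).

(** Inductive presentation of piecewise smoothness on an arbitrary segment, in
    which juxtaposition, reparametrization and reversal are immediate, whereas
    partitions would have to be reindexed each time. *)
Inductive pw_smooth c : R -> R -> Prop :=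
| pw_segment a b : a < b -> smooth_on_segment c a b -> pw_smooth c a b
| pw_cat a b d : pw_smooth c a b -> pw_smooth c b d -> pw_smooth c a d.

Lemma pw_smooth_lt c a b : pw_smooth c a b -> a < b.
Proof. by elim=> // {}a {}b d _ ab _; exact: lt_trans. Qed.

Lemma pw_smoothP c a b : a < b -> (exists2 s : seq R, itv_partition a b s &
    forall i, (i < size s)%N ->
      smooth_on_segment c (nth 0 (a :: s) i) (nth 0 s i)) <-> pw_smooth c a b.
Proof.
move=> ab; split; last first.
  move=> {ab}; elim=> {a b} [a b ab sab|a b d _ [s1 p1 c1] _ [s2 p2 c2]].
    by exists [:: b]; [exact: itv_partition1|case].
  exists (s1 ++ s2); first exact: itv_partition_cat p1 p2.
  move=> i; rewrite size_cat => is12; rewrite -cat_cons !nth_cat /=.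
  have [is1|s1i] := ltnP i (size s1); first by rewrite leqW//; exact: c1.
  have {}is12 : (i - size s1 < size s2)%N by rewrite ltn_subLR.
  have := c2 _ is12; case: p1 => _ /eqP <-.
  move: s1i; rewrite leq_eqVlt => /orP[/eqP <-|s1i].
    by rewrite leqnn subnn /= nth_last.
  by rewrite ltnS leqNgt s1i /= -(subnSK s1i).
case=> s; elim: s a ab => [|x s IH] a ab ps cs.
  by move: (itv_partition_nil ps) ab => ->; rewrite ltxx.
have ax : a < x by case: ps => /= /andP[].
have ps' := itv_partition_cons ps.
have sax : smooth_on_segment c a x := cs 0%N isT.
case: s => [|y s] in IH ps ps' cs *.
  by rewrite -(itv_partition_nil ps'); exact: pw_segment.
apply: pw_cat (pw_segment ax sax) _.
apply: IH => //; first exact: itv_partition_size_neq0 ps'.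
by move=> i; exact: cs i.+1.
Qed.

Lemma piecewise_smoothP c : piecewise_smooth c <-> pw_smooth c 0 1.
Proof. exact: pw_smoothP ltr01. Qed.

(** Inside a piece, the curve coincides near t with a smooth extension of that
    piece; the exceptional points are the junctions. *)
Lemma pw_smooth_generic c a b : pw_smooth c a b ->
  exists s : seq R, forall t, a < t < b -> t \notin s -> smooth_curve_at c t.
Proof.
elim=> {a b} [a b ab [d cd]|a b d _ [s1 c1] _ [s2 c2]].
  exists [::] => t /andP[at_ tb] _.
  have [_ dt] := cd t (ltac:(by rewrite !ltW)).
  apply: near_eq_vsmooth_at dt.
  have : \forall s \near t, s \in `]a, b[%R by apply: near_in_itvoo; rewrite in_itv /= at_.
  apply: filterS => s; rewrite in_itv /= => /andP[as_ sb].
  by have [] := cd s (ltac:(by rewrite !ltW)).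
exists (b :: s1 ++ s2) => t /andP[at_ td].
rewrite inE mem_cat !negb_or => /and3P[tb ts1 ts2].
move: tb; rewrite neq_lt => /orP[tb|bt]; first by apply: c1; rewrite ?at_.
by apply: c2; rewrite ?bt.
Qed.

Lemma eq_pw_smooth c c' a b : (forall t, a <= t <= b -> c t = c' t) ->
  pw_smooth c a b -> pw_smooth c' a b.
Proof.
move=> + pc; elim: pc => {a b} [a b ab [d cd]|a b d p1 IH1 p2 IH2] cc'.
  apply: pw_segment => //; exists d => t tab.
  by have [ctd dt] := cd t tab; rewrite -cc'.
have ab := pw_smooth_lt p1; have bd := pw_smooth_lt p2.
apply: (@pw_cat _ _ b).
  by apply: IH1 => t /andP[at_ tb]; apply: cc'; rewrite at_ (le_trans tb (ltW bd)).
by apply: IH2 => t /andP[bt td]; apply: cc'; rewrite td (le_trans (ltW ab) bt).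
Qed.

Lemma pw_smooth_affine c alpha beta a b : 0 < alpha ->
  pw_smooth c a b ->
  pw_smooth (fun t => c (alpha * t + beta)) ((a - beta) / alpha) ((b - beta) / alpha).
Proof.
move=> al0; elim=> {a b} [a b ab [d cd]|a b d _ p1 _ p2]; last exact: pw_cat p1 p2.
apply: pw_segment; first by rewrite ltr_pM2r ?invr_gt0// ltrD2r.
exists (fun t => d (alpha * t + beta)) => t.
rewrite ler_pdivrMr// ler_pdivlMr// lerBlDr lerBrDr (mulrC t) => /cd[-> dt].
by split=> //; exact: smooth_curve_affine.
Qed.

Lemma pw_smooth_reverse c beta a b : pw_smooth c a b ->
  pw_smooth (fun t => c (- 1 * t + beta)) (beta - b) (beta - a).
Proof.
elim=> {a b} [a b ab [d cd]|a b d _ p1 _ p2]; last exact: pw_cat p2 p1.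
apply: pw_segment; first by rewrite ltrD2l ltrN2.
exists (fun t => d (- 1 * t + beta)) => t tab.
have [->] : c (- 1 * t + beta) = d (- 1 * t + beta) /\ smooth_curve_at d (- 1 * t + beta).
  by apply: cd; move: tab => /andP[h1 h2]; apply/andP; split; lra.
by split=> //; exact: smooth_curve_affine.
Qed.

End piecewise.

Lemma pw_smooth_comp {R : realType} {m n : nat} {M : manifoldType R m}
    {N : manifoldType R n} (c : R -> M) (F : M -> N) a b :
  (forall p, smooth_at F p) -> pw_smooth c a b -> pw_smooth (F \o c) a b.
Proof.
move=> sF; elim=> {a b} [a b ab [d cd]|a b d _ p1 _ p2]; last exact: pw_cat p1 p2.
apply: pw_segment => //; exists (F \o d) => t /cd[/= -> dt]; split=> //.
exact: vsmooth_at_comp.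
Qed.

(** * Development of curves *)

Section lie_group.
Context {R : realType} {n : nat} {G : lieGroupType R n}.

Lemma smooth_at_mull (g x : G) : smooth_at (fun y : G => (g * y)%g) x.
Proof. by apply: smooth2_at_left; exact: mulg_smooth. Qed.

Lemma smooth_at_mulr (g x : G) : smooth_at (fun y : G => (y * g)%g) x.
Proof. by apply: smooth2_at_right; exact: mulg_smooth. Qed.

Lemma smooth_at_conj (g x : G) : smooth_at (fun y : G => (g * y * g^-1)%g) x.
Proof.
apply: (smooth_at_comp (F := fun y : G => (g * y)%g) (G := fun y : G => (y * g^-1)%g)).
  exact: smooth_at_mull.
exact: smooth_at_mulr.
Qed.

(** The logarithmic derivative c^-1 c'. The factor (c t)^-1 is constant in s. *)
Definition log_derivative (c : R -> G) (t : R) : 'rV[R]_n :=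
  velocity (fun s => ((c t)^-1 * c s)%g) t.

Lemma maurer_cartan_velocity (c : R -> G) t : smooth_curve_at c t ->
  maurer_cartan (c t) (velocity c t) = log_derivative c t.
Proof.
move=> sc; apply/esym.
by apply: (velocity_comp (F := fun x : G => ((c t)^-1 * x)%g)) => //; exact: smooth_at_mull.
Qed.

Lemma log_derivative_mull (g : G) (c : R -> G) t :
  log_derivative (fun s => (g * c s)%g) t = log_derivative c t.
Proof.
apply: eq_velocity => s.
by rewrite invgM mulgA -(mulgA _ g^-1%g g) mulVg mulg1.
Qed.

(** The curve s |-> c(t)^-1 c(s) passes through 1 at s = t, and conjugating c by g
    conjugates this curve by g. Ad g is the differential of conjugation at 1. *)
Lemma log_derivative_conj (g : G) (c : R -> G) t : smooth_curve_at c t ->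
  log_derivative (fun s => (g * c s * g^-1)%g) t = Ad g (log_derivative c t).
Proof.
move=> sc; rewrite /log_derivative /Ad.
have sl : smooth_curve_at (fun s => ((c t)^-1 * c s)%g) t.
  by apply: (vsmooth_at_comp sc); exact: smooth_at_mull.
have := velocity_comp (F := fun y : G => (g * y * g^-1)%g) sl (smooth_at_conj _ _).
rewrite mulVg => <-; apply: eq_velocity => s /=.
by rewrite !invgM invgK !mulgA mulgVK.
Qed.

Lemma near_eq_log_derivative (c c' : R -> G) t :
  (\forall s \near t, c s = c' s) -> log_derivative c t = log_derivative c' t.
Proof.
move=> cc'; apply: near_eq_velocity; rewrite (nbhs_singleton cc').
by apply: filterS cc' => s ->.
Qed.

Lemma log_derivative_affine (c : R -> G) alpha beta t :
  smooth_curve_at c (alpha * t + beta) ->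
  log_derivative (fun s => c (alpha * s + beta)) t =
  alpha *: log_derivative c (alpha * t + beta).
Proof.
move=> sc; rewrite /log_derivative -velocity_affine//.
by apply: (vsmooth_at_comp sc); exact: smooth_at_mull.
Qed.

End lie_group.

Section development.
Context {R : realType} {n m k : nat} {G : lieGroupType R n}.
Context {X : model_geometry G} {M : manifoldType R m} {P : manifoldType R k}.
Variable C : cartan_geometry X M P.
Implicit Types (c : R -> P) (cG : R -> G) (a b t : R) (h : G).

(** Smoothness of both curves at t is included so that the chain rule applies to
    the equation; piecewise smooth curves have it at all but finitely many points. *)
Definition develops_at c cG t : Prop :=
  [/\ smooth_curve_at c t, smooth_curve_at cG t &
      cartan_form C (c t) (velocity c t) = log_derivative cG t].

Definition development_on c cG a b : Prop :=
  [/\ pw_smooth c a b, pw_smooth cG a b & exists s : seq R,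
      forall t, a < t < b -> t \notin s -> develops_at c cG t].

Lemma is_developmentP c cG : piecewise_smooth c /\ is_development C c cG <->
  development_on c cG 0 1 /\ cG 0 = 1%g.
Proof.
split=> [[/piecewise_smoothP pc [/piecewise_smoothP pG cG0 [s ceq]]]|].
  split=> //; split=> //.
  have [s1 sc] := pw_smooth_generic pc; have [s2 sG] := pw_smooth_generic pG.
  exists (s ++ s1 ++ s2) => t t01; rewrite !mem_cat !negb_or => /and3P[ts ts1 ts2].
  split; [exact: sc|exact: sG|].
  by rewrite ceq// maurer_cartan_velocity//; exact: sG.
move=> [[pc pG [s ceq]] cG0]; split; first exact/piecewise_smoothP.
split=> //; first exact/piecewise_smoothP.
exists s => t t01 ts; have [_ sG ->] := ceq t t01 ts.
by rewrite maurer_cartan_velocity.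
Qed.

Lemma near_eq_develops_at c c' cG cG' t : (\forall s \near t, c s = c' s) ->
  (\forall s \near t, cG s = cG' s) -> develops_at c cG t -> develops_at c' cG' t.
Proof.
move=> cc' GG' [sc sG E]; split.
- exact: near_eq_vsmooth_at sc.
- exact: near_eq_vsmooth_at sG.
- by rewrite -(near_eq_velocity cc') -(nbhs_singleton cc') E; exact: near_eq_log_derivative.
Qed.

Lemma eq_development_on c c' cG cG' a b :
  (forall t, a <= t <= b -> c t = c' t) ->
  (forall t, a <= t <= b -> cG t = cG' t) ->
  development_on c cG a b -> development_on c' cG' a b.
Proof.
move=> cc' GG' [pc pG [s ceq]]; split.
- exact: eq_pw_smooth pc.
- exact: eq_pw_smooth pG.
exists s => t tab ts; have nt : \forall s \near t, a <= s <= b.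
  have : \forall s \near t, s \in `]a, b[%R by apply: near_in_itvoo; rewrite in_itv.
  by apply: filterS => r; rewrite in_itv /= => /andP[/ltW -> /ltW ->].
by apply: near_eq_develops_at (ceq t tab ts); apply: filterS nt => r; [exact: cc'|exact: GG'].
Qed.

Lemma development_on_cat c cG a b d : development_on c cG a b ->
  development_on c cG b d -> development_on c cG a d.
Proof.
move=> [pc1 pG1 [s1 c1]] [pc2 pG2 [s2 c2]].
split; [exact: pw_cat pc1 pc2|exact: pw_cat pG1 pG2|].
exists (b :: s1 ++ s2) => t /andP[at_ td].
rewrite inE mem_cat !negb_or => /and3P[tb ts1 ts2].
move: tb; rewrite neq_lt => /orP[tb|bt]; first by apply: c1; rewrite ?at_.
by apply: c2; rewrite ?bt.
Qed.

Lemma develops_at_affine c cG alpha beta t :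
  develops_at c cG (alpha * t + beta) ->
  develops_at (fun s => c (alpha * s + beta)) (fun s => cG (alpha * s + beta)) t.
Proof.
move=> [sc sG E]; split; [exact: smooth_curve_affine..|].
by rewrite velocity_affine// log_derivative_affine// linearZ /= E.
Qed.

Lemma development_on_affine c cG alpha beta a b : 0 < alpha ->
  development_on c cG a b ->
  development_on (fun t => c (alpha * t + beta)) (fun t => cG (alpha * t + beta))
    ((a - beta) / alpha) ((b - beta) / alpha).
Proof.
move=> al0 [pc pG [s ceq]]; split; [exact: pw_smooth_affine..|].
exists [seq (x - beta) / alpha | x <- s] => t.
rewrite ltr_pdivrMr// ltr_pdivlMr// ltrBlDr ltrBrDr (mulrC t) => tab ts.
apply: develops_at_affine; apply: ceq => //.
apply: contra ts => ts; apply/mapP; exists (alpha * t + beta) => //.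
by rewrite addrK mulrAC mulfV ?mul1r// gt_eqF.
Qed.

Lemma development_on_reverse c cG beta a b :
  development_on c cG a b ->
  development_on (fun t => c (- 1 * t + beta)) (fun t => cG (- 1 * t + beta))
    (beta - b) (beta - a).
Proof.
move=> [pc pG [s ceq]]; split; [exact: pw_smooth_reverse..|].
exists [seq beta - x | x <- s] => t /andP[h1 h2] ts.
apply: develops_at_affine; apply: ceq; first by apply/andP; split; lra.
apply: contra ts => ts; apply/mapP; exists (- 1 * t + beta) => //.
by rewrite mulN1r opprD opprK addrCA subrr addr0.
Qed.

Lemma smooth_at_act h u : stabilizer X h -> smooth_at (act C ^~ h) u.
Proof.
move=> Hh; apply: (smooth2_on_right (A := setT) openT _ Hh) => //.
exact: act_smooth (cartan_bundle C).
Qed.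

Lemma development_on_mull g c cG a b : development_on c cG a b ->
  development_on c (fun t => (g * cG t)%g) a b.
Proof.
move=> [pc pG [s ceq]]; split => //.
  by apply: (pw_smooth_comp (F := fun y : G => (g * y)%g)) pG => x; exact: smooth_at_mull.
exists s => t tab ts; have [sc sG E] := ceq t tab ts; split=> //.
  by apply: (vsmooth_at_comp sG); exact: smooth_at_mull.
by rewrite log_derivative_mull.
Qed.

Lemma stabilizerV h : stabilizer X h -> stabilizer X h^-1%g.
Proof.
move=> /mem_set Hh; apply: set_mem.
exact: (group_closedV (stabilizer_subgroup X)).
Qed.

Lemma stabilizerM h h' : stabilizer X h -> stabilizer X h' -> stabilizer X (h * h')%g.
Proof.
move=> /mem_set Hh /mem_set Hh'; apply: set_mem.
exact: (group_closedM (stabilizer_subgroup X)).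
Qed.

Lemma actVK h u : stabilizer X h -> act C (act C u h) h^-1%g = u.
Proof.
move=> Hh; rewrite -(actM (cartan_bundle C))//; last exact: stabilizerV.
by rewrite mulgV (act1 (cartan_bundle C)).
Qed.

(** Equivariance of the Cartan form turns right translation by h into Ad h^-1,
    which is also the effect of conjugation by h^-1 on logarithmic derivatives. *)
Lemma development_on_act h c cG a b : stabilizer X h -> development_on c cG a b ->
  development_on (fun t => act C (c t) h) (fun t => (h^-1 * cG t * h)%g) a b.
Proof.
move=> Hh [pc pG [s ceq]].
have -> : (fun t => (h^-1 * cG t * h)%g) = (fun t => (h^-1 * cG t * h^-1^-1)%g).
  by rewrite invgK.
split.
- by apply: (pw_smooth_comp (F := act C ^~ h)) pc => u; exact: smooth_at_act.
- apply: (pw_smooth_comp (F := fun y : G => (h^-1 * y * h^-1^-1)%g)) pG.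
  by move=> x; exact: smooth_at_conj.
exists s => t tab ts; have [sc sG E] := ceq t tab ts; split.
- by apply: (vsmooth_at_comp (F := act C ^~ h) sc); exact: smooth_at_act.
- apply: (vsmooth_at_comp (F := fun y : G => (h^-1 * y * h^-1^-1)%g) sG).
  exact: smooth_at_conj.
rewrite log_derivative_conj// -E -cartan_form_act//; congr (cartan_form C _ _).
by apply: (velocity_comp (F := act C ^~ h)) => //; exact: smooth_at_act.
Qed.

End development.

(** * Developments between points *)

Section develops.
Context {R : realType} {n m k : nat} {G : lieGroupType R n}.
Context {X : model_geometry G} {M : manifoldType R m} {P : manifoldType R k}.
Variable C : cartan_geometry X M P.
Implicit Types (u v w : P) (g h : G).

Lemma develops_path u v g : develops C u v g <->
  exists (c : R -> P) (cG : R -> G) (h : G),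
    [/\ development_on C c cG 0 1, cG 0 = 1%g & stabilizer X h] /\
    [/\ c 0 = u, act C (c 1) h = v & (cG 1%R * h)%g = g].
Proof.
split=> -[c [cG [h [[h1 h2 h3] E]]]]; exists c, cG, h; split=> //.
  by have [] := (is_developmentP C c cG).1 (conj h1 h2).
by have [] := (is_developmentP C c cG).2 (conj h1 h2).
Qed.

(** Any curve on any segment may be used to exhibit a development: rescale it to
    the unit interval, and translate its companion in G so as to start at 1. *)
Lemma develops_of_path (c : R -> P) (cG : R -> G) (a b : R) h : a < b ->
  development_on C c cG a b -> stabilizer X h ->
  develops C (c a) (act C (c b) h) ((cG a)^-1 * cG b * h)%g.
Proof.
move=> ab dev Hh; have ba0 : 0 < b - a by rewrite subr_gt0.
apply/develops_path.
exists (fun t => c ((b - a) * t + a)),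
  (fun t => ((cG a)^-1 * cG ((b - a) * t + a)%R)%g), h.
rewrite !mulr0 !mulr1 !add0r !subrK mulVg; split; split=> //.
apply: (development_on_mull _ (cG := fun t => cG ((b - a) * t + a))).
have := development_on_affine a ba0 dev.
by rewrite subrr mul0r divff ?gt_eqF.
Qed.

(** The path from u to v ends at v h1^-1, so the path from v to w is first moved by
    h1^-1. Its development is then conjugated by h1, and translated by G1 1 to
    start where the first one ends. The elements of H telescope:
    G1 1 * (h1 * G2 1 * h1^-1) * (h1 * h2) = (G1 1 * h1) * (G2 1 * h2). *)
Lemma develops_trans u v w g g' : develops C u v g -> develops C v w g' ->
  develops C u w (g * g')%g.
Proof.
move=> /develops_path[c1 [G1 [h1 [[d1 G10 H1] [<- v1 <-]]]]].
move=> /develops_path[c2 [G2 [h2 [[d2 G20 H2] [v2 <- <-]]]]].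
have H1' := stabilizerV H1.
have /(development_on_mull (G1 1)) := development_on_act H1' d2.
move/(development_on_affine (-1) ltr01).
rewrite invgK !opprK add0r !divr1.
set c2' := fun t => act C _ _; set G2' := fun t => (_ * _)%g => d2'.
(* The second curve has been shifted to the segment from 1 to 2. *)
pose c t := if t <= 1 then c1 t else c2' t.
pose cG t := if t <= 1 then G1 t else G2' t.
have E1 t : t <= 1 -> c t = c1 t by rewrite /c => ->.
have E1' t : t <= 1 -> cG t = G1 t by rewrite /cG => ->.
have E2 t : 1 <= t -> c t = c2' t.
  rewrite /c le_eqVlt => /orP[/eqP<-|]; last by rewrite ltNge => /negbTE ->.
  by rewrite lexx /c2' mul1r subrr v2 -v1 actVK.
have E2' t : 1 <= t -> cG t = G2' t.
  rewrite /cG le_eqVlt => /orP[/eqP<-|]; last by rewrite ltNge => /negbTE ->.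
  by rewrite lexx /G2' mul1r subrr G20 mulg1 mulgV mulg1.
have d12 : development_on C c cG 0 (1 + 1).
  apply: (@development_on_cat _ _ _ _ _ _ _ _ _ _ _ _ 1).
    by apply: eq_development_on d1 => t /andP[_ t1]; rewrite ?E1 ?E1'.
  by apply: eq_development_on d2' => t /andP[t1 _]; rewrite ?E2 ?E2'.
have lt02 : (0 : R) < 1 + 1 by rewrite ltr_wpDr.
have le12 : (1 : R) <= 1 + 1 by rewrite lerDl.
have := develops_of_path lt02 d12 (stabilizerM H1 H2).
rewrite E1// E1'// E2// E2'// G10 invg1 mul1g /c2' /G2' mul1r addrK.
rewrite (actM (cartan_bundle C))// -{2}(invgK h1) actVK//.
by rewrite !mulgA mulgVK.
Qed.

(** The path is moved by h, so that it ends at v, and run backwards; it then ends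
    at u h. *)
Lemma develops_sym u v g : develops C u v g -> develops C v u g^-1%g.
Proof.
move=> /develops_path[c [cG [h [[d G0 Hh] [<- <- <-]]]]].
have d' := development_on_reverse 1 (development_on_act Hh d).
rewrite subrr subr0 in d'.
have := develops_of_path ltr01 d' (stabilizerV Hh).
rewrite mulr0 mulr1 add0r addNr actVK// G0 mulg1 mulVg mulg1.
by rewrite !invgM invgK !mulgA mulgK.
Qed.

Lemma develops_automorphism phi u v g : automorphism C phi ->
  develops C u v g -> develops C (phi u) (phi v) g.
Proof.
move=> [sphi _ eqv pull] /develops_path[c [cG [h [[[pc pG [s ceq]] G0 Hh] [<- <- <-]]]]].
apply/develops_path; exists (phi \o c), cG, h; split; last by rewrite /= -eqv.
split=> //; split=> //; first exact: pw_smooth_comp.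
exists s => t t01 ts; have [sc sG E] := ceq t t01 ts; split=> //.
  exact: vsmooth_at_comp.
by rewrite velocity_comp//= pull.
Qed.

(** A vector killed by the differential of phi is killed by the Cartan form, hence
    zero; so phi^-1 is smooth by the inverse function theorem. That it preserves
    the Cartan form follows from the chain rule for phi \o psi = id. *)
Lemma automorphism_inverse phi psi : automorphism C phi ->
  cancel phi psi -> cancel psi phi -> automorphism C psi.
Proof.
move=> [sphi _ eqv pull] phiK psiK.
have inj u (v : 'rV[R]_k) : tangent_map phi u v = 0 -> v = 0.
  move=> E; apply: (bij_inj (cartan_form_bij C u)).
  by rewrite -pull E !linear0.
have spsi u : smooth_at psi u.
  by rewrite -(psiK u); apply: smooth_at_inverse => //; exact: inj.
split; [exact: spsi|by exists phi|move=> u h Hh|move=> u v].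
  by rewrite -{1}(psiK u) -eqv// phiK.
rewrite -pull.
have E := tangent_map_comp (spsi u) (sphi (psi u)).
have id_E : phi \o psi = id by apply/funext.
rewrite id_E in E.
have Ev : tangent_map phi (psi u) (tangent_map psi u v) = v :=
  etrans (esym (congr1 (@^~ v) E)) (tangent_map_id u v).
by rewrite Ev psiK.
Qed.

End develops.

Section normalizer.
Context {G : groupType} (J : set G) (g : G).

Lemma normalizerV : normalizer J g -> normalizer J g^-1%g.
Proof.
move=> gJ; rewrite /normalizer /= -{1}gJ.
apply/seteqP; split=> [_ [_ [j Jj <-] <-]|j Jj].
  by rewrite invgK !mulgA mulgV mul1g mulgK.
by exists (g^-1 * j * g)%g; [exists j|rewrite invgK !mulgA mulgV mul1g mulgK].
Qed.

Lemma conj_setM h : normalizer J g -> conj_set J (g * h)%g = conj_set J h.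
Proof.
move=> gJ; rewrite -{2}gJ.
apply/seteqP; split=> [_ [j Jj <-]|_ [_ [j Jj <-] <-]].
  by exists (g^-1 * j * g)%g; [exists j|rewrite invgM !mulgA].
by exists j => //; rewrite invgM !mulgA.
Qed.

End normalizer.

Section rcoset.
Context {R : realType} {n m k : nat} {G : lieGroupType R n}.
Context {X : model_geometry G} {M : manifoldType R m} {P : manifoldType R k}.
Variable C : cartan_geometry X M P.

(** A development g of u from o is one of phi u from phi o, and g0 * g is one of
    phi u from o. The two conjugates of J agree because g0 normalizes J. *)
Lemma automorphism_rcoset_sub o J phi u : automorphism C phi ->
  curved_lcoset C o (normalizer J) (phi o) ->
  phi @` curved_rcoset C o J u `<=` curved_rcoset C o J (phi u).
Proof.
move=> aphi [g0 NJg0 og0] _ [v [g og [g' Jg' ug']] <-].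
exists (g0 * g)%g; first exact: develops_trans og0 (develops_automorphism aphi og).
rewrite conj_setM//; exists g' => //; exact: develops_automorphism.
Qed.

End rcoset.

Theorem theorem6p3 (R : realType) (n m k : nat) (G : lieGroupType R n)
    (X : model_geometry G) (M : manifoldType R m) (P : manifoldType R k)
    (C : cartan_geometry X M P) (o : P) (J : set G) (phi : P -> P) :
  connected [set: M] ->
  subgroup J ->
  holonomy C o `<=` J ->
  automorphism C phi ->
  curved_lcoset C o (normalizer J) (phi o) ->
  forall u : P,
    phi @` curved_rcoset C o J u = curved_rcoset C o J (phi u).
Proof.
move=> _ _ _ aphi ophi u; apply/seteqP; split.
  exact: automorphism_rcoset_sub.
have [_ [psi phiK psiK] _ _] := aphi.
have apsi := automorphism_inverse aphi phiK psiK.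
have opsi : curved_lcoset C o (normalizer J) (psi o).
  have [g Ng og] := ophi; exists g^-1%g; first exact: normalizerV.
  by have := develops_sym (develops_automorphism apsi og); rewrite phiK.
move=> v Jv; exists (psi v); last exact: psiK.
by rewrite -(phiK u); apply: (automorphism_rcoset_sub apsi opsi); exists v.
Qed.
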